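(* Let $X$ be a stratified Lowen fuzzy topological space. The following statements hold. (i) If $X$ is Lowen fuzzy compact and $FT_2$, then $X$ is exponentiable in $\mathbf{LFTS}$. (ii) If $X$ is strongly fuzzy compact and $FT_2$, then $X$ is exponentiable in $\mathbf{LFTS}$. (iii) If $X$ is $N$-compact and $FT_2$, then $X$ is exponentiable in $\mathbf{LFTS}$.
   Context: Let $\mathbb{I}=[0,1]$ with its usual order; joins and meets of $\mathbb{I}$-valued maps are pointwise. A (stratified) Lowen fuzzy topology on a set $X$ is a subset $\tau_X\subseteq\mathbb{I}^X$ containing all constant maps and closed under arbitrary pointwise joins and finite pointwise meets; $(X,\tau_X)$ is a stratified Lowen fuzzy topological space, and members of $\tau_X$ are called open. A map $f:X\to Y$ is continuous if $v\circ f\in\tau_X$ for all $v\in\tau_Y$. $\mathbf{LFTS}$ is the category of these spaces and continuous maps; its binary product $Z\times X$ carries the least Lowen topology containing $a\circ\mathrm{pr}_Z$ ($a\in\tau_Z$) and $b\circ\mathrm{pr}_X$ ($b\in\tau_X$). $X$ is exponentiable in $\mathbf{LFTS}$ if the functor $-\times X:\mathbf{LFTS}\to\mathbf{LFTS}$ has a right adjoint. For $x\in X$ and $0<\alpha\le1$, the fuzzy point $x_\alpha$ has value $\alpha$ at $x$ and $0$ elsewhere; its support is $x$. Fuzzy sets $A,B\in\mathbb{I}^X$ are quasi-coincident, $A\,q\,B$, if $A(z)+B(z)>1$ for some $z\in X$. A fuzzy set $N$ is a $Q$-neighbourhood of $x_\alpha$ if some $U\in\tau_X$ satisfies $x_\alpha\,q\,U$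 and $U\le N$. So an open $U$ is a $Q$-neighbourhood of $x_\alpha$ iff $U(x)>1-\alpha$. $X$ is fuzzy Hausdorff ($FT_2$) if, whenever $x_\alpha$ and $y_\beta$ ($\alpha,\beta\in(0,1]$) have different supports ($x\ne y$), they possess open $Q$-neighbourhoods $U,V$ respectively such that $U\wedge V=0$. $X$ is Lowen fuzzy compact if for every $a\in(0,1]$ and every $\mathcal{U}\subseteq\tau_X$ with $\bigvee_{U\in\mathcal{U}}U(x)\ge a$ for all $x\in X$, and for every $0<b<a$, there is a finite $\mathcal{U}_0\subseteq\mathcal{U}$ with $\bigvee_{U\in\mathcal{U}_0}U(x)\ge b$ for all $x\in X$. $X$ is strongly fuzzy compact if for every $a\in[0,1)$ and every $\mathcal{U}\subseteq\tau_X$ with $\bigvee_{U\in\mathcal{U}}U(x)>a$ for all $x\in X$, there is a finite $\mathcal{U}_0\subseteq\mathcal{U}$ with $\bigvee_{U\in\mathcal{U}_0}U(x)>a$ for all $x\in X$. For $\alpha\in(0,1]$, $\mathcal{U}\subseteq\tau_X$ is an open $\alpha$-$Q$-cover of $X$ if for every $x\in X$ there is $U\in\mathcal{U}$ with $x_\alpha\,q\,U$, equivalently $\bigvee_{U\in\mathcal{U}}U(x)>1-\alpha$ for all $x\in X$; it is an $\alpha^{-}$-$Q$-cover if there is a single $\beta\in(0,\alpha)$ for which it is a $\beta$-$Q$-cover. $X$ is $N$-compact if for every $\alpha\in(0,1]$ each open $\alpha$-$Q$-cover contains a finite subfamily that is an $\alpha^{-}$-$Q$-cover. *)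

(* Defs.v *)
From HB Require Import structures.
From mathcomp Require Import all_boot all_order all_algebra.
From mathcomp Require Import interval_inference.
From mathcomp Require Import all_classical all_reals.

Set Implicit Arguments.
Unset Strict Implicit.
Unset Printing Implicit Defensive.
Import Order.TTheory GRing.Theory Num.Theory.
Local Open Scope classical_set_scope.
Local Open Scope ring_scope.

Record category := Category {
  obj :> Type;
  hom : obj -> obj -> Type;
  idc : forall A, hom A A;
  comp : forall A B C, hom B C -> hom A B -> hom A C;
  comp_idl : forall A B (f : hom A B), comp (idc B) f = f;
  comp_idr : forall A B (f : hom A B), comp f (idc A) = f;
  comp_assoc : forall A B C D (h : hom C D) (g : hom B C) (f : hom A B),
    comp h (comp g f) = comp (comp h g) f }.

Record functor (C D : category) := Functor {
  fobj :> C -> D;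
  fmap : forall A B : C, hom A B -> hom (fobj A) (fobj B);
  fmap_id : forall A : C, fmap (idc A) = idc (fobj A);
  fmap_comp : forall (A B B' : C) (g : hom B B') (f : hom A B),
    fmap (comp g f) = comp (fmap g) (fmap f) }.

Definition is_right_adjoint (C D : category) (F : functor C D)
    (G : functor D C) : Prop :=
  exists phi : forall (c : C) (d : D), hom (F c) d -> hom c (G d),
    (forall c d, bijective (phi c d)) /\
    (forall (c' c : C) (d d' : D) (u : hom c' c) (v : hom d d')
            (h : hom (F c) d),
       phi c' d' (comp v (comp h (fmap F u))) =
       comp (fmap G v) (comp (phi c d h) u)).

Definition has_right_adjoint (C D : category) (F : functor C D) : Prop :=
  exists G : functor D C, is_right_adjoint F G.

Definition fuzzy (R : realType) (X : Type) : Type := X -> {i01 R}.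

Section FuzzySets.
Context {R : realType} {X : Type}.
Implicit Types (A B : fuzzy R X) (F T : set (fuzzy R X)).

Definition fjoin F : fuzzy R X :=
  fun x => supremum 0%:i01 [set U x | U in F].

Definition fmeet A B : fuzzy R X := fun x => Order.min (A x) (B x).

Definition fle A B : Prop := forall x, A x <= B x.

Lemma fjoin_isLub F x : isLub [set U x | U in F] (fjoin F x).
Proof.
rewrite /fjoin; set S := [set U x | U in F].
have [S0|/set0P Sn0] := eqVneq S set0.
  by rewrite S0 supremum0; split => // b _; rewrite -num_le /=.
pose S' : set R := [set s%:num | s in S].
have S'1 : ubound S' 1 by move=> _ [s _ <-].
have S'n0 : S' !=set0 by case: Sn0 => s Ss; exists s%:num, s.
have supS' : has_sup S' by split => //; exists 1.
have s0 : 0 <= sup S'.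
  have [r S'r] := S'n0; apply: (@le_trans _ _ r); last first.
    by apply: ub_le_sup => //; exists 1.
  by case: S'r => s Ss <-.
have s1 : sup S' <= 1 by exact: ge_sup.
have hs : isLub S (Itv01 s0 s1).
  split.
    move=> s Ss; rewrite -num_le /=.
    by apply: ub_le_sup; [exists 1|exists s].
  move=> b bS; rewrite -num_le /=; apply: ge_sup => // _ [s Ss <-].
  by rewrite num_le; exact: bS.
rewrite /supremum ifF; last by apply/negbTE/set0P.
case: xgetP => [y _ [yS ly]|]; first by split.
by move=> /(_ (Itv01 s0 s1)); case; split; case: hs.
Qed.

(* Closure under the empty meet follows from [cst 1%:i01] being open. *)
Record lowen_topology T : Prop := LowenTopology {
  open_cst : forall c : {i01 R}, T (cst c);
  open_fjoin : forall F, F `<=` T -> T (fjoin F);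
  open_fmeet : forall A B, T A -> T B -> T (fmeet A B) }.

Lemma smallest_lowen_topology (S : set (fuzzy R X)) :
  lowen_topology (smallest lowen_topology S).
Proof.
split.
- by move=> c T [[]].
- by move=> F FS T TS; case: (TS) => -[_ + _] _; apply=> U /FS; exact.
- by move=> A B SA SB T TS; case: (TS) => -[_ _ +] _; apply; [exact: SA|exact: SB].
Qed.

End FuzzySets.

Lemma fjoin_comp (R : realType) (X Y : Type) (f : X -> Y)
    (F : set (fuzzy R Y)) :
  fjoin F \o f = fjoin [set V \o f | V in F].
Proof. by apply/funext => x; rewrite /fjoin /= image_comp. Qed.

Record lfts (R : realType) := LFTS {
  carrier :> Type;
  opens : set (fuzzy R carrier);
  opensP : lowen_topology opens }.
Arguments opens {R} _ _.

Definition lcontinuous (R : realType) (X Y : lfts R) (f : X -> Y) : Prop :=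
  forall V : fuzzy R Y, opens Y V -> opens X (V \o f).

Record lmap (R : realType) (X Y : lfts R) := LMap {
  lmap_fun :> X -> Y;
  lmapP : lcontinuous lmap_fun }.

Section LFTSCategory.
Context {R : realType}.
Implicit Types X Y Z : lfts R.

Lemma lmap_eq X Y (f g : lmap X Y) : lmap_fun f = lmap_fun g -> f = g.
Proof.
case: f g => f fc [g gc] /= fg.
by case: _ / fg in gc *; congr LMap; exact: Prop_irrelevance.
Qed.

Definition lid X : lmap X X := @LMap R X X idfun (fun V oV => oV).

Definition lcomp X Y Z (g : lmap Y Z) (f : lmap X Y) : lmap X Z :=
  @LMap R X Z (g \o f) (fun V oV => lmapP f (lmapP g oV)).

Definition LFTS_category : category.
Proof.
by refine (@Category (lfts R) (@lmap R) lid lcomp _ _ _) => *; exact: lmap_eq.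
Defined.

Definition lprod_opens Z X : set (fuzzy R (Z * X)%type) :=
  smallest lowen_topology
    ([set a \o fst | a in opens Z] `|` [set b \o snd | b in opens X]).
Arguments lprod_opens Z X _ : clear implicits.

Definition lprod Z X : lfts R :=
  LFTS (smallest_lowen_topology _ : lowen_topology (lprod_opens Z X)).

Lemma lprod_map_continuous X Z Z' (f : lmap Z Z') :
  @lcontinuous R (lprod Z X) (lprod Z' X) (fun p => (f p.1, p.2)).
Proof.
set fX := fun p => _; move=> V.
suff: opens (lprod Z' X) `<=` [set W : fuzzy R _ | opens (lprod Z X) (W \o fX)] by apply.
apply: smallest_sub.
  have [oc oj om] : lowen_topology (opens (lprod Z X)) := opensP _.
  split => [c|F FT|A B /= TA TB]; first exact: oc; last exact: om.
  by rewrite /= fjoin_comp; apply: oj => _ [U /FT ? <-].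
move=> _ [[a oa <-]|[b ob <-]]; apply: sub_gen_smallest.
- by left; exists (a \o f) => //; exact: lmapP.
- by right; exists b.
Qed.

Definition lprod_map X Z Z' (f : lmap Z Z') : lmap (lprod Z X) (lprod Z' X) :=
  LMap (@lprod_map_continuous X Z Z' f).

Definition lprod_functor X : functor LFTS_category LFTS_category.
Proof.
by refine (@Functor LFTS_category LFTS_category
             (fun Z => lprod Z X) (@lprod_map X) _ _) => *;
  apply: lmap_eq; apply/funext => -[].
Defined.

Definition exponentiable X : Prop := has_right_adjoint (lprod_functor X).

End LFTSCategory.

Section Properties.
Context {R : realType} (X : lfts R).
Implicit Types (A B N U V : fuzzy R X) (a b alpha beta : {i01 R}).

Definition fpoint (x : X) alpha : fuzzy R X :=
  fun z => if `[< z = x >] then alpha else 0%:i01.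

Definition quasi_coincident A B : Prop :=
  exists z, 1 < (A z)%:num + (B z)%:num.

Definition Qneighbourhood (x : X) alpha N : Prop :=
  exists U, [/\ opens X U, quasi_coincident (fpoint x alpha) U & fle U N].

Definition FT2 : Prop :=
  forall (x y : X) alpha beta, 0%:i01 < alpha -> 0%:i01 < beta -> x <> y ->
  exists U V, [/\ opens X U /\ Qneighbourhood x alpha U,
                  opens X V /\ Qneighbourhood y beta V
                & fmeet U V = cst 0%:i01].

Definition lowen_compact : Prop :=
  forall a, 0%:i01 < a ->
  forall UU : set (fuzzy R X), UU `<=` opens X ->
  (forall x, a <= fjoin UU x) ->
  forall b, 0%:i01 < b -> b < a ->
  exists UU0 : set (fuzzy R X),
    [/\ finite_set UU0, UU0 `<=` UU & forall x, b <= fjoin UU0 x].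

Definition strongly_compact : Prop :=
  forall a, a < 1%:i01 ->
  forall UU : set (fuzzy R X), UU `<=` opens X ->
  (forall x, a < fjoin UU x) ->
  exists UU0 : set (fuzzy R X),
    [/\ finite_set UU0, UU0 `<=` UU & forall x, a < fjoin UU0 x].

Definition open_Qcover alpha (UU : set (fuzzy R X)) : Prop :=
  UU `<=` opens X /\
  forall x, exists2 U, UU U & quasi_coincident (fpoint x alpha) U.

Definition open_Qcover_minus alpha (UU : set (fuzzy R X)) : Prop :=
  exists beta, [/\ 0%:i01 < beta, beta < alpha & open_Qcover beta UU].

Definition N_compact : Prop :=
  forall alpha, 0%:i01 < alpha ->
  forall UU : set (fuzzy R X), open_Qcover alpha UU ->
  exists UU0 : set (fuzzy R X),
    [/\ finite_set UU0, UU0 `<=` UU & open_Qcover_minus alpha UU0].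

End Properties.

(* Main.v *)
Require Import Defs.
From mathcomp Require Import all_boot all_order all_algebra.
From mathcomp Require Import interval_inference lra.
From mathcomp Require Import all_classical all_reals.

(** Each of the three compactness notions implies Lowen compactness, and a
Lowen compact FT2 space X is exponentiable because infima over the whole of X
provide enough open fuzzy sets of maps to make evaluation continuous.

The candidate exponential is the set of continuous maps from X to Y with its
finest splitting topology: a fuzzy set of maps is open as soon as its pullback
along the transpose of every continuous map from some product Z x X to Y is
open.  Transposes are then continuous by construction, and everything reduces
to the continuity of evaluation.

Two facts give this continuity.  The first is the fuzzy form of the tube lemma
([open_finf]): if X is Lowen compact and h is open on Z x X, then the infimum
over x of h(z,x) is open in z.  Hence if h is replaced by V o f joined with a
fixed open D of X, the infimum over x is an open fuzzy set of maps f.  The second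
([compact_FT2_separation]): if g is open and t < g(x0), there are opens B and D
with t < B(x0), B and D disjoint, and g \/ D >= t everywhere.  It comes from
covering X by g and by opens that FT2 separates from x0.

Let g be V o f0, with t < V(f0(x0)), and put
A(f) = inf_x max(V(f(x)), D(x)).  Then A is open and A(f0) >= t.  Where B is
nonzero, D vanishes, so A(f) /\ B(x) <= V(f(x)) for all f and x.  Thus
evaluation is bounded below, near any (f0, x0) and up to any level below its
value, by an open fuzzy set of the product; this is openness.  Only the whole
space X has to be compact, so no local compactness has to be derived from
FT2. *)

Set Implicit Arguments.
Unset Strict Implicit.
Unset Printing Implicit Defensive.
Import Order.TTheory GRing.Theory Num.Theory.
Local Open Scope classical_set_scope.
Local Open Scope ring_scope.

(** * Joins, infima and the local description of open fuzzy sets *)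

Section FuzzyOrder.
Context {R : realType}.
Implicit Types c t : {i01 R}.

Lemma i01_ge0 c : 0%:i01 <= c.
Proof. by rewrite -num_le /=. Qed.

Lemma i01_le1 c : c <= 1%:i01.
Proof. by rewrite -num_le /=. Qed.

Lemma i01_dense t c : t < c -> exists d : {i01 R}, t < d /\ d < c.
Proof.
rewrite -num_lt => tc.
have m0 : 0 <= (t%:num + c%:num) / 2 by rewrite divr_ge0 ?addr_ge0.
have m1 : (t%:num + c%:num) / 2 <= 1.
  apply: (@le_trans _ _ c%:num) => //.
  by apply/ltW; exact: (midf_lt tc).2.
by exists (Itv01 m0 m1); rewrite -!num_lt /=; have [] := midf_lt tc.
Qed.

Context {X : Type}.
Implicit Types (A B U V : fuzzy R X) (F T : set (fuzzy R X)).

Lemma fjoin_ub F U x : F U -> U x <= fjoin F x.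
Proof. by move=> FU; apply: (fjoin_isLub F x).1; exists U. Qed.

Lemma lt_fjoin F x t : t < fjoin F x -> exists2 U, F U & t < U x.
Proof.
move=> tF; apply: contrapT => H; move: tF; apply/negP; rewrite -leNgt.
apply: (fjoin_isLub F x).2 => _ [U FU <-]; rewrite leNgt; apply/negP => tU.
by apply: H; exists U.
Qed.

(** Openness can be checked pointwise: a fuzzy set is the join of its open
minorants as soon as these reach every level below each of its values. *)
Lemma open_local T W : lowen_topology T ->
  (forall x t, t < W x -> exists A, [/\ T A, fle A W & t <= A x]) -> T W.
Proof.
move=> topT locW.
suff -> : W = fjoin [set A | T A /\ fle A W].
  by apply: (open_fjoin topT) => A [].
apply/funext => x; apply/eqP; rewrite eq_le; apply/andP; split; last first.
  by apply: (fjoin_isLub _ x).2 => _ [A [_ AW] <-]; exact: AW.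
rewrite leNgt; apply/negP => /i01_dense[d [d1 d2]].
have [A [TA AW dA]] := locW _ _ d2.
have /(le_trans dA) : A x <= fjoin [set A | T A /\ fle A W] x.
  exact: fjoin_ub.
by rewrite leNgt d1.
Qed.

Lemma open_max T A B : lowen_topology T -> T A -> T B ->
  T (fun x => Order.max (A x) (B x)).
Proof.
move=> topT TA TB; apply: (open_local topT) => x t; rewrite lt_max.
case/orP => /ltW tx; [exists A|exists B]; split=> // y; rewrite le_max lexx //.
by rewrite orbT.
Qed.

End FuzzyOrder.

Section Infimum.
Context {R : realType} {X : Type}.
Implicit Types (g : fuzzy R X) (c : {i01 R}).

(** Infima are built as joins of lower bounds on the one-point space, so that
the lemmas on [fjoin] apply to them. *)
Definition finf g : {i01 R} :=
  fjoin [set (cst c : fuzzy R unit) | c in [set c | forall x, c <= g x]] tt.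

Lemma finf_lb g x : finf g <= g x.
Proof.
by apply: (fjoin_isLub _ tt).2 => _ [_ [c cg <-] <-]; exact: cg.
Qed.

Lemma le_finf g c : (forall x, c <= g x) -> c <= finf g.
Proof. by move=> cg; apply: (@fjoin_ub R unit _ (cst c) tt); exists c. Qed.

End Infimum.

(** * Finite intersections, products and the tube lemma *)

Section Products.
Context {R : realType}.
Implicit Types (X Y Z : lfts R).

(** In a compactness argument each member of the finite subfamily comes with
its own neighbourhood of a point; this one serves them all. *)
Lemma finite_common_nbhd Z (z : Z) (t : {i01 R}) (I : choiceType)
    (Q : I -> set (fuzzy R Z)) (S : set I) :
  t < 1%:i01 ->
  (forall i A B, fle A B -> Q i B -> Q i A) ->
  finite_set S ->
  (forall i, S i -> exists A, [/\ opens Z A, t < A z & Q i A]) ->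
  exists A, [/\ opens Z A, t < A z & forall i, S i -> Q i A].
Proof.
move=> t1 Qle /finite_seqP[s ->]; elim: s => [_|i s IH H].
  by exists (cst 1%:i01); split => //; exact: open_cst (opensP Z) _.
have [|A [oA tA QA]] := IH.
  by move=> j js; apply: H; rewrite /= inE js orbT.
have [|B [oB tB QB]] := H i; first by rewrite /= inE eqxx.
exists (fmeet A B); split; first exact: open_fmeet (opensP Z) _ _ oA oB.
  by rewrite /fmeet lt_min tA.
move=> j; rewrite /= inE => /orP[/eqP ->|js].
  by apply: Qle QB => y; rewrite /fmeet ge_min lexx orbT.
by apply: Qle (QA _ js) => y; rewrite /fmeet ge_min lexx.
Qed.

Definition box Z X (a : fuzzy R Z) (b : fuzzy R X) : fuzzy R (Z * X) :=
  fmeet (a \o fst) (b \o snd).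

Lemma open_box Z X a b : opens Z a -> opens X b -> opens (lprod Z X) (box a b).
Proof.
move=> oa ob; apply: open_fmeet (opensP _) _ _ _ _; apply: sub_gen_smallest.
- by left; exists a.
- by right; exists b.
Qed.

Lemma open_prod_local Z X (h : fuzzy R (Z * X)) z x t :
  opens (lprod Z X) h -> t < h (z, x) ->
  exists a b, [/\ opens Z a /\ opens X b, t < a z, t < b x & fle (box a b) h].
Proof.
pose P := [set h : fuzzy R (Z * X) | forall z x t, t < h (z, x) ->
  exists a b, [/\ opens Z a /\ opens X b, t < a z, t < b x & fle (box a b) h]].
suff: opens (lprod Z X) `<=` P by move=> /[apply]; exact.
move=> {h z x t}; have oZ := opensP Z; have oX := opensP X.
apply: smallest_sub.
  split.
  - move=> c z x t tc; exists (cst c), (cst c); split => //.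
    + by split; [exact: open_cst oZ _|exact: open_cst oX _].
    + by move=> p; rewrite /box /fmeet /= minxx.
  - move=> F FP z x t tF; have [U FU tU] := lt_fjoin tF.
    have [a [b [oab ta tb abU]]] := FP _ FU _ _ _ tU; exists a, b; split => // p.
    exact: le_trans (abU p) (fjoin_ub p FU).
  - move=> A B PA PB z x t; rewrite /fmeet lt_min => /andP[].
    move=> /PA[a [b [[oa ob] ta tb abA]]] /PB[a' [b' [[oa' ob'] ta' tb' abB]]].
    exists (fmeet a a'), (fmeet b b'); split.
    + by split; [exact: open_fmeet oZ _ _ oa oa'|exact: open_fmeet oX _ _ ob ob'].
    + by rewrite lt_min ta.
    + by rewrite lt_min tb.
    + move=> p; rewrite /box /fmeet /= minACA le_min.
      apply/andP; split; rewrite ge_min.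
      * by rewrite [X in X || _](abA p).
      * by rewrite [X in _ || X](abB p) orbT.
move=> _ [[a oa <-]|[b ob <-]] z x t /= th.
- exists a, (cst 1%:i01); split => //.
  + by split=> //; exact: open_cst oX _.
  + exact: lt_le_trans th (i01_le1 _).
  + by move=> p; rewrite /box /fmeet /= ge_min lexx.
- exists (cst 1%:i01), b; split => //.
  + by split=> //; exact: open_cst oZ _.
  + exact: lt_le_trans th (i01_le1 _).
  + by move=> p; rewrite /box /fmeet /= ge_min lexx orbT.
Qed.

Lemma lprod_snd_open Z X b :
  opens X b -> opens (lprod Z X) (b \o snd).
Proof. by move=> ob; apply: sub_gen_smallest; right; exists b. Qed.

(** Stratification enters here: slicing a basic open a(z) /\ b(x) at z leaves
the constant a(z), which has to be open. *)
Lemma open_slice Z X (h : fuzzy R (Z * X)) z :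
  opens (lprod Z X) h -> opens X (fun x => h (z, x)).
Proof.
move=> oh; apply: (open_local (opensP X)) => x t.
move=> /(open_prod_local oh)[a [b [[oa ob] ta tb abh]]].
exists (fmeet (cst (a z)) b); split.
- by apply: open_fmeet (opensP X) _ _ _ ob; exact: open_cst (opensP X) _.
- by move=> y; exact: (abh (z, y)).
- by rewrite /fmeet le_min !ltW.
Qed.

(** Fuzzy tube lemma.  For a level t below the infimum at z, those b that form,
with some a exceeding t at z, a box below h cover X up to that infimum; the meet
of the a's belonging to a finite subcover is the required neighbourhood of z. *)
Lemma open_finf Z X (h : fuzzy R (Z * X)) :
  lowen_compact X -> opens (lprod Z X) h ->
  opens Z (fun z => finf (fun x => h (z, x))).
Proof.
move=> cX oh; apply: (open_local (opensP Z)) => z t tz.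
have [d [td dz]] := i01_dense tz.
pose UU := [set b | opens X b /\
  exists a, [/\ opens Z a, t < a z & fle (box a b) h]].
have [|x|UU0 [finU sUU dU]] := cX _ (le_lt_trans (i01_ge0 t) tz) UU _ _ d
    (le_lt_trans (i01_ge0 t) td) dz.
- by move=> b [].
- apply: le_trans (finf_lb _ x) _; rewrite leNgt; apply/negP.
  move=> /i01_dense[s [s1 s2]].
  (* Above t, so that b falls in UU; above the join at x, to contradict it. *)
  have /(open_prod_local oh) : Order.max s t < h (z, x).
    by rewrite gt_max s2 (lt_le_trans tz) // finf_lb.
  move=> [a [b [[oa ob]]]]; rewrite !gt_max => /andP[_ ta] /andP[sb _] abh.
  have : b x <= fjoin UU x by apply: fjoin_ub; split => //; exists a.
  by rewrite leNgt (lt_trans s1).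
have [|||A [oA tA Ah]] := @finite_common_nbhd Z z t _
    (fun b => [set a | fle (box a b) h]) UU0 _ _ finU.
- exact: lt_le_trans td (i01_le1 _).
- move=> b A B AB Bh p; apply: le_trans (Bh p).
  by rewrite /box /fmeet le_min !ge_min AB lexx orbT.
- by move=> b /sUU[_].
exists (fmeet A (cst t)); split.
- by apply: open_fmeet (opensP Z) _ _ oA _; exact: open_cst (opensP Z) _.
- move=> w; apply: le_finf => x.
  have [b Ub tb] := lt_fjoin (lt_le_trans td (dU x)).
  apply: le_trans (Ah _ Ub (w, x)).
  by rewrite /box /fmeet /= le_min !ge_min lexx (ltW tb) orbT.
- by rewrite /fmeet le_min lexx andbT ltW.
Qed.

End Products.

(** * Separation and compactness *)

Section SeparationCompactness.
Context {R : realType} {X : lfts R}.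
Implicit Types (a b c t alpha : {i01 R}) (x y : X) (U V g : fuzzy R X).

Lemma quasi_coincident_fpointE x alpha U :
  quasi_coincident (fpoint x alpha) U <-> 1 < alpha%:num + (U x)%:num.
Proof.
split => [[z]|xU]; last by exists x; rewrite /fpoint asboolT.
rewrite /fpoint; case: asboolP => [->//|_] /=.
by rewrite add0r ltNge; case/negP.
Qed.

Definition i01_compl c : {i01 R} := (1 - c%:num)%:i01.

(** The points of height 1 - c turn quasi-coincidence into exceeding c. *)
Lemma FT2_separation c x y : FT2 X -> c < 1%:i01 -> x <> y ->
  exists U V, [/\ opens X U /\ c < U x, opens X V /\ c < V y
                & fmeet U V = cst 0%:i01].
Proof.
move=> h2 c1 xy; have cp : 0%:i01 < i01_compl c.
  by rewrite -num_lt /= subr_gt0 (num_lt c 1%:i01).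
have [U [V [[oU nU] [oV nV] UV]]] := h2 x y _ _ cp cp xy.
have Qlt (z : X) W : Qneighbourhood z (i01_compl c) W -> c < W z.
  move=> [W' [_ /quasi_coincident_fpointE qW W'W]]; apply: lt_le_trans (W'W z).
  by rewrite -num_lt; move: qW; rewrite /= -addrA ltrDl addrC subr_gt0.
by exists U, V; split=> //; split=> //; exact: Qlt.
Qed.

Definition separable_opens x t : set (fuzzy R X) :=
  [set W | opens X W /\ exists B,
    [/\ opens X B, t < B x & fmeet B W = cst 0%:i01]].

(** Every y other than x0 lies, at a level above t, in an open disjoint from a
neighbourhood of x0, and g takes care of x0 itself.  In a finite subcover the
opens other than g have join D, disjoint from the meet B of the corresponding
neighbourhoods of x0. *)
Lemma compact_FT2_separation g x0 t :
  lowen_compact X -> FT2 X -> opens X g -> t < g x0 ->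
  exists B D, [/\ opens X B /\ opens X D, t < B x0,
    forall x, 0%:i01 < B x -> D x = 0%:i01
  & forall x, t <= Order.max (g x) (D x)].
Proof.
move=> cX h2 og tg.
have [c [tc cg]] := i01_dense tg; have [d [td dc]] := i01_dense tc.
have t_ge0 := i01_ge0 t.
set sep := separable_opens x0 t.
have [|x|UU0 [finU sUU dU]] := cX c (le_lt_trans t_ge0 tc) (g |` sep) _ _ d
    (le_lt_trans t_ge0 td) dc.
- by move=> W [->|[]].
- have [->|xx0] := pselect (x = x0).
    by apply: le_trans (ltW cg) _; apply: fjoin_ub; left.
  have [|U [V [[oU cU] [oV cV] UV]]] := FT2_separation (c := c) h2 _ (nesym xx0).
    exact: lt_le_trans cg (i01_le1 _).
  apply: le_trans (ltW cV) _; apply: fjoin_ub; right; split => //.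
  by exists U; split => //; exact: lt_trans cU.
have finS : finite_set (UU0 `&` sep) by exact: finite_setIl.
have [|||B [oB tB Bsep]] := @finite_common_nbhd R X x0 t _
    (fun W => [set B | fmeet B W = cst 0%:i01]) (UU0 `&` sep) _ _ finS.
- exact: lt_le_trans tg (i01_le1 _).
- move=> W A A' AA' A'W; apply/funext => x; apply/eqP.
  rewrite eq_le i01_ge0 andbT -[leRHS](congr1 (@^~ x) A'W) /fmeet.
  by rewrite le_min !ge_min AA' lexx orbT.
- by move=> W [_ []].
exists B, (fjoin (UU0 `&` sep)); split => //.
- by split => //; apply: open_fjoin (opensP X) _ _ => W [_ []].
- move=> x Bx; apply/eqP; rewrite eq_le i01_ge0 andbT leNgt; apply/negP => Dx.
  have [W SW Wx] := lt_fjoin Dx; have /(congr1 (@^~ x)) := Bsep _ SW.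
  by rewrite /fmeet /= => /eqP; rewrite gt_eqF // lt_min Bx.
- move=> x; have [W UW tW] := lt_fjoin (lt_le_trans td (dU x)).
  apply: le_trans (ltW tW) _; rewrite le_max.
  have [->|sW] := sUU _ UW; first by rewrite lexx.
  by rewrite (@fjoin_ub _ _ _ W) ?orbT.
Qed.

Lemma strongly_compact_lowen : strongly_compact X -> lowen_compact X.
Proof.
move=> cX a a0 UU oU aU b b0 ba.
have [||UU0 [finU sU bU]] := cX b _ UU oU.
- exact: lt_le_trans ba (i01_le1 _).
- by move=> x; exact: lt_le_trans (aU x).
by exists UU0; split => // x; exact: ltW.
Qed.

(** Quasi-coincidence with points of height 1 - a means exceeding a; the
resulting finite Q-cover at some beta < 1 - a lies above 1 - beta > a. *)
Lemma N_compact_strongly : N_compact X -> strongly_compact X.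
Proof.
move=> cX a a1 UU oU aU.
have a'0 : 0%:i01 < i01_compl a.
  by rewrite -num_lt /= subr_gt0 (num_lt a 1%:i01).
have [|UU0 [finU sU [beta [b0 ba [_ bU]]]]] := cX _ a'0 UU.
  split => // x; have [U UUU aUx] := lt_fjoin (aU x); exists U => //.
  apply/quasi_coincident_fpointE.
  by rewrite /= -addrA ltrDl addrC subr_gt0 num_lt.
exists UU0; split => // x; have [U UU0U /quasi_coincident_fpointE bUx] := bU x.
apply: lt_le_trans (fjoin_ub x UU0U); rewrite -num_lt.
move: ba; rewrite -num_lt /= => ba.
by move: bUx; have := ba; lra.
Qed.

End SeparationCompactness.

(** * The function space *)

Section FunctionSpace.
Context {R : realType}.
Variable X : lfts R.
Implicit Types Y Z : lfts R.

Lemma slice_continuous Z Y (h : lmap (lprod Z X) Y) (z : Z) :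
  @lcontinuous R X Y (fun x => h (z, x)).
Proof.
by move=> V oV; apply: (@open_slice R Z X (V \o h)); exact: lmapP.
Qed.

Definition slice Z Y (h : lmap (lprod Z X) Y) (z : Z) : lmap X Y :=
  LMap (slice_continuous h z).

Definition splitting_opens Y : set (fuzzy R (lmap X Y)) :=
  [set W : fuzzy R (lmap X Y) | forall Z (h : lmap (lprod Z X) Y), opens Z (W \o slice h)].

Lemma splitting_topology Y : lowen_topology (@splitting_opens Y).
Proof.
split=> [c Z h|F oF Z h|A B oA oB Z h].
- exact: open_cst (opensP Z) _.
- rewrite fjoin_comp; apply: open_fjoin (opensP Z) _ _.
  by move=> _ [U /oF oU <-]; exact: oU.
- by apply: open_fmeet (opensP Z) _ _ _ _; [exact: oA|exact: oB].
Qed.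

Definition function_space Y : lfts R := LFTS (@splitting_topology Y).

Definition curry Z Y (h : lmap (lprod Z X) Y) : lmap Z (function_space Y) :=
  @LMap R Z (function_space Y) (slice h) (fun W oW => oW Z h).

Lemma postcompose_continuous Y Y' (v : lmap Y Y') :
  @lcontinuous R (function_space Y) (function_space Y')
    (fun f : lmap X Y => lcomp v f).
Proof.
move=> W oW Z h /=.
have -> : (W \o (fun f : lmap X Y => lcomp v f)) \o slice h =
          W \o slice (lcomp v h).
  by apply/funext => z /=; congr W; apply: lmap_eq.
exact: oW.
Qed.

Definition postcompose Y Y' (v : lmap Y Y') :
  lmap (function_space Y) (function_space Y') :=
  LMap (@postcompose_continuous Y Y' v).

Definition function_space_functor :
  functor (@LFTS_category R) (@LFTS_category R).
Proof.
by refine (@Functor LFTS_category LFTS_category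
             function_space postcompose _ _) => *;
  apply: lmap_eq; apply/funext => f; apply: lmap_eq.
Defined.

(** [Order.max (V (f x)) (D x)] is the pullback of V joined with D, so its
infimum over x is open in f by the tube lemma; together with B it gives the
open minorants of V o ev. *)
Lemma eval_continuous Y : lowen_compact X -> FT2 X ->
  @lcontinuous R (lprod (function_space Y) X) Y
    (fun p : lmap X Y * X => p.1 p.2).
Proof.
move=> cX h2 V oV; apply: (open_local (opensP _)) => -[f0 x0] t /= tV.
have [B [D [[oB oD] tB BD tVD]]] :=
  compact_FT2_separation cX h2 (lmapP f0 oV) tV.
pose A : fuzzy R (function_space Y) :=
  fun f : lmap X Y => finf (fun x => Order.max (V (f x)) (D x)).
have oA : opens (function_space Y) A.
  move=> Z h.
  apply: (@open_finf R Z X (fun p => Order.max (V (h p)) (D p.2))) => //.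
  apply: (@open_max _ _ _ (V \o h) (D \o snd) (opensP _)).
    exact: lmapP.
  exact: lprod_snd_open.
exists (box A B); split; first exact: open_box.
- move=> -[f x]; rewrite /box /fmeet /= ge_min.
  have [Bx|] := ltP 0%:i01 (B x); last first.
    by move=> Bx; rewrite (le_trans Bx) ?i01_ge0 ?orbT.
  apply/orP; left; apply: le_trans (finf_lb _ x) _.
  by rewrite BD // ge_max lexx i01_ge0.
- by rewrite /box /fmeet /= le_min (ltW tB) andbT; exact: le_finf.
Qed.

Lemma compact_FT2_exponentiable :
  lowen_compact X -> FT2 X -> exponentiable X.
Proof.
move=> cX h2; exists function_space_functor, curry; split; last first.
  by move=> Z' Z Y Y' u v h; apply: lmap_eq; apply/funext => z; apply: lmap_eq.
move=> Z Y.
pose ev := LMap (eval_continuous (Y := Y) cX h2).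
exists (fun k : lmap Z (function_space Y) => lcomp ev (lprod_map X k)).
- by move=> h; apply: lmap_eq; apply/funext => -[].
- by move=> k; apply: lmap_eq; apply/funext => z; apply: lmap_eq.
Qed.

End FunctionSpace.

Theorem theorem6p6 (R : realType) (X : lfts R) :
  [/\ lowen_compact X -> FT2 X -> exponentiable X,
      strongly_compact X -> FT2 X -> exponentiable X
    & N_compact X -> FT2 X -> exponentiable X].
Proof.
split=> cX; apply: compact_FT2_exponentiable => //.
- exact: strongly_compact_lowen.
- exact: strongly_compact_lowen (N_compact_strongly cX).
Qed.
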